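(* Let $P \in \mathcal P(\mathbb S^{d-1})$ be rotationally symmetric around $\mu \in \mathbb S^{d-1}$. Then $$\max\left\{\mathrm{ahD}(\mu;P), \mathrm{ahD}(-\mu;P)\right\} = \max_{x \in \mathbb S^{d-1}} \mathrm{ahD}(x;P).$$
   Context: Let $d \ge 2$ be an integer, $\mathbb S^{d-1} = \{x \in \mathbb R^d : \|x\| = 1\}$, and let $\mathcal P(\mathbb S^{d-1})$ be the set of Borel probability measures on $\mathbb S^{d-1}$. For a Borel set $A \subseteq \mathbb R^d$ and $P \in \mathcal P(\mathbb S^{d-1})$, write $P(A) = P(A \cap \mathbb S^{d-1})$. For $u \in \mathbb S^{d-1}$ let $H_{0,u} = \{y \in \mathbb R^d : \langle y,u\rangle \ge 0\}$. The angular halfspace depth is $$\mathrm{ahD}(x;P) = \inf\{P(H_{0,u}) : u \in \mathbb S^{d-1},\ x \in H_{0,u}\},\qquad x \in \mathbb S^{d-1}.$$ A distribution $P \in \mathcal P(\mathbb S^{d-1})$ is rotationally symmetric around $\mu \in \mathbb S^{d-1}$ if, for $X \sim P$, the random vector $OX$ has the same distribution as $X$ for every orthogonal matrix $O \in \mathbb R^{d\times d}$ with $O\mu = \mu$. *)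

(* Defs.v *)
(* The dimension is d = n.+1, so the sphere S^(d-1) is [sphere R n], a subset
   of R^d = 'cV[R]_n.+1. *)
From HB Require Import structures.
From mathcomp Require Import all_boot all_order all_algebra.
From mathcomp Require Import all_classical all_reals all_analysis.

Set Implicit Arguments.
Unset Strict Implicit.
Unset Printing Implicit Defensive.

Import Order.TTheory GRing.Theory Num.Theory.
Import numFieldNormedType.Exports.

Local Open Scope classical_set_scope.
Local Open Scope ring_scope.

Definition dotv (R : realType) (d : nat) (x y : 'cV[R]_d) : R :=
  \sum_(i < d) x i 0 * y i 0.

(* The library norm `|x| on matrices is the max norm, hence this definition. *)
Definition enorm (R : realType) (d : nat) (x : 'cV[R]_d) : R :=
  Num.sqrt (dotv x x).

Definition sphere (R : realType) (n : nat) : set 'cV[R]_n.+1 :=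
  [set x | enorm x = 1].

Definition sphereT (R : realType) (n : nat) : Type := set_type (@sphere R n).

Lemma sphere_delta (R : realType) (n : nat) :
  (delta_mx 0 0 : 'cV[R]_n.+1) \in @sphere R n.
Proof.
rewrite inE /sphere /= /enorm /dotv (bigD1 0) //= big1 => [|i /negPf i0].
  by rewrite mxE !eqxx mulr1 addr0 sqrtr1.
by rewrite mxE i0 mul0r.
Qed.

(* [sphereT] carries the subspace topology; measurable types are pointed. *)
HB.instance Definition _ (R : realType) (n : nat) :=
  Topological.on (sphereT R n).
HB.instance Definition _ (R : realType) (n : nat) :=
  isPointed.Build (sphereT R n)
    (exist _ (delta_mx 0 0) (sphere_delta R n)).

Definition borel_sphere (R : realType) (n : nat) :=
  g_sigma_algebraType (@open (sphereT R n)).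

Definition borel_space (R : realType) (d : nat) :=
  g_sigma_algebraType (@open 'cV[R]_d).

Definition sphere_incl (R : realType) (n : nat) (x : borel_sphere R n) :
    borel_space R n.+1 :=
  val (x : set_type (@sphere R n)).

(* P(A) = P(A \cap S^(d-1)) for A a subset of R^d. *)
Definition sphere_prob (R : realType) (n : nat)
    (P : probability (borel_sphere R n) R) (A : set 'cV[R]_n.+1) : \bar R :=
  P [set x | A (sphere_incl x)].

Definition halfspace0 (R : realType) (d : nat) (u : 'cV[R]_d) : set 'cV[R]_d :=
  [set y | 0 <= dotv y u].

Definition ahD (R : realType) (n : nat)
    (P : probability (borel_sphere R n) R) (x : 'cV[R]_n.+1) : \bar R :=
  ereal_inf [set sphere_prob P (halfspace0 u) |
             u in [set u | sphere u /\ halfspace0 u x]].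

Definition orthogonal_mx (R : realType) (d : nat) (O : 'M[R]_d) : Prop :=
  O^T *m O = 1%:M.

(* With X ~ P realized as the inclusion of (S^(d-1), P) into R^d, the laws of
   O X and of X are the two pushforwards, compared on all Borel sets. *)
Definition rotationally_symmetric (R : realType) (n : nat)
    (P : probability (borel_sphere R n) R) (mu : 'cV[R]_n.+1) : Prop :=
  forall O : 'M[R]_n.+1, orthogonal_mx O -> O *m mu = mu ->
  forall A : set (borel_space R n.+1), measurable A ->
    pushforward P
      (fun x : borel_sphere R n => (O *m sphere_incl x : borel_space R n.+1)) A
    = pushforward P (@sphere_incl R n) A.

(* m = max A: m is attained in A and bounds A. *)
Definition is_max (R : realType) (A : set (\bar R)) (m : \bar R) : Prop :=
  A m /\ ubound A m.

(* Main.v *)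
Require Import Defs.
From mathcomp Require Import all_boot all_order all_algebra.
From mathcomp Require Import all_classical all_reals all_analysis.
From mathcomp Require Import lra.

Import Order.TTheory GRing.Theory Num.Theory.
Import numFieldNormedType.Exports.

Local Open Scope classical_set_scope.
Local Open Scope ring_scope.

(** Write [x = s mu + y] and [u = t mu + w] with [y] and [w] orthogonal to
    [mu], so that [<x, u> = s t + <y, w>].  The half-turn about the axis of
    [mu] (it fixes [mu] and negates its orthogonal complement) turns [u] into
    [t mu - w], whose product with [x] is [s t - <y, w>].  If [s] and [t] have
    the same sign, one of the two products is nonnegative, so one of the two
    halfspaces contains [x].  Both have the same probability, since [P] is
    invariant under the half-turn ([sphere_prob_halfspace0_tr]).

    If [s >= 0], this applies to every [u] with [<mu, u> >= 0], that is to
    every halfspace competing in the infimum that defines [ahD P mu]; hence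
    [ahD P x <= ahD P mu].  If [s <= 0], the same argument with [- mu], about
    which [P] is symmetric too, gives [ahD P x <= ahD P (- mu)].  These two
    cases are one lemma, [ahD_le_axis].  The bound is attained because [mu] and
    [- mu] lie on the sphere. *)

Section DotProduct.
Context {R : realType} {d : nat}.
Implicit Types (x y u mu : 'cV[R]_d) (O : 'M[R]_d).

Lemma dotvE x y : dotv x y = (x^T *m y) 0 0.
Proof. by rewrite mxE; apply: eq_bigr => i _; rewrite mxE. Qed.

Lemma dotvC x y : dotv x y = dotv y x.
Proof. by apply: eq_bigr => i _; rewrite mulrC. Qed.

Lemma dotvNl x y : dotv (- x) y = - dotv x y.
Proof. by rewrite !dotvE linearN mulNmx mxE. Qed.

Lemma dotvNN x y : dotv (- x) (- y) = dotv x y.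
Proof. by rewrite dotvNl dotvC dotvNl opprK dotvC. Qed.

Lemma dotv_mulmxr O x u : dotv x (O *m u) = dotv (O^T *m x) u.
Proof. by rewrite !dotvE trmx_mul trmxK mulmxA. Qed.

Lemma enorm_orthogonal_mx O u : orthogonal_mx O -> enorm (O *m u) = enorm u.
Proof. by move=> OO; rewrite /enorm dotv_mulmxr mulmxA OO mul1mx. Qed.

Lemma enorm1_dotv x : enorm x = 1 -> dotv x x = 1.
Proof.
move=> x1; rewrite -[LHS]sqr_sqrtr; first by rewrite -/(enorm x) x1 expr1n.
by apply: sumr_ge0 => i _; exact: sqr_ge0.
Qed.

Definition half_turn mu : 'M[R]_d := 2 *: (mu *m mu^T) - 1%:M.

Lemma half_turnE mu x : half_turn mu *m x = (2 * dotv mu x) *: mu - x.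
Proof.
rewrite mulmxBl mul1mx -scalemxAl -mulmxA (mx11_scalar (mu^T *m x)) -dotvE.
by rewrite mul_mx_scalar scalerA.
Qed.

Lemma tr_half_turn mu : (half_turn mu)^T = half_turn mu.
Proof. by rewrite linearB linearZ /= trmx_mul trmxK trmx1. Qed.

Lemma half_turn_fix mu : dotv mu mu = 1 -> half_turn mu *m mu = mu.
Proof. by move=> m1; rewrite half_turnE m1 mulr1 scaler_nat mulr2n addrK. Qed.

Lemma half_turn_orthogonal mu : dotv mu mu = 1 -> orthogonal_mx (half_turn mu).
Proof.
move=> m1; rewrite /orthogonal_mx tr_half_turn {2}/half_turn mulmxBr mulmx1.
rewrite -scalemxAr mulmxA half_turn_fix // /half_turn opprB addrC.
by rewrite subrK.
Qed.

Lemma dotv_half_turn mu x u :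
  dotv x (half_turn mu *m u) = 2 * dotv mu u * dotv x mu - dotv x u.
Proof.
by rewrite half_turnE !dotvE mulmxBr -scalemxAr !mxE.
Qed.

Lemma measurable_halfspace0 u :
  measurable (halfspace0 u : set (borel_space R d)).
Proof.
rewrite -[X in measurable X]setCK; apply: measurableC; apply: sub_sigma_algebra.
rewrite openC; apply: preimage_closed (@closed_ge R 0) => x _.
apply: continuous_big => [|i _ y]; first exact: add_continuous.
by apply: (@cvgMr_tmp _ _ (nbhs y)); exact: coord_continuous.
Qed.

End DotProduct.

Section AngularHalfspaceDepth.
Context {R : realType} {n : nat}.
Variable P : probability (borel_sphere R n) R.
Implicit Types (x u mu : 'cV[R]_n.+1) (O : 'M[R]_n.+1).

Lemma sphereN x : sphere x -> sphere (- x).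
Proof. by rewrite /sphere /= /enorm dotvNN. Qed.

Lemma rotationally_symmetricN mu :
  rotationally_symmetric P mu -> rotationally_symmetric P (- mu).
Proof.
by move=> h O OO; rewrite mulmxN => /oppr_inj; exact: h.
Qed.

(** [O x] lies in the halfspace of [u] iff [x] lies in that of [O^T u], so
    the two probabilities are those of one halfspace under the laws of [O X]
    and of [X]. *)
Lemma sphere_prob_halfspace0_tr mu O u :
  rotationally_symmetric P mu -> orthogonal_mx O -> O *m mu = mu ->
  sphere_prob P (halfspace0 (O^T *m u)) = sphere_prob P (halfspace0 u).
Proof.
move=> h OO Omu; rewrite /sphere_prob.
have := h O OO Omu _ (measurable_halfspace0 u); rewrite /pushforward => <-.
congr (P _); apply/seteqP.
by split=> x /=; rewrite /halfspace0 /= dotv_mulmxr trmxK.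
Qed.

(** The products of [x] with [u] and with the half-turned [u] have mean
    [<mu, u> <x, mu>].  When this is nonnegative, one of the two halfspaces
    contains [x], and it has the probability of the halfspace of [u]; so each
    value competing for [ahD P mu] also competes for [ahD P x]. *)
Lemma ahD_le_axis mu x :
  sphere mu -> rotationally_symmetric P mu -> 0 <= dotv x mu ->
  (ahD P x <= ahD P mu)%E.
Proof.
move=> /enorm1_dotv mu1 hP x_mu.
apply: le_ereal_inf_tmp => _ [u [su mu_u] <-].
have [xu|xu] := leP 0 (dotv x u); first by apply: ereal_inf_lbound; exists u.
have OO := half_turn_orthogonal _ mu1.
apply: ereal_inf_lbound; exists (half_turn mu *m u).
  split; first by rewrite /sphere /= enorm_orthogonal_mx.
  rewrite /halfspace0 /= dotv_half_turn.
  have : 0 <= dotv mu u * dotv x mu by exact: mulr_ge0.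
  lra.
rewrite -{1}tr_half_turn.
by apply: sphere_prob_halfspace0_tr hP OO _; exact: half_turn_fix.
Qed.

End AngularHalfspaceDepth.

Theorem theorem8 (R : realType) (n : nat) (hd : (2 <= n.+1)%N)
    (P : probability (borel_sphere R n) R)
    (mu : 'cV[R]_n.+1) (hmu : sphere mu)
    (hP : rotationally_symmetric P mu) :
  is_max [set ahD P x | x in @sphere R n]
         (Order.max (ahD P mu) (ahD P (- mu))).
Proof.
split.
  rewrite /Order.max; case: ifP => _.
    by exists (- mu) => //; exact: sphereN.
  by exists mu.
move=> _ [x _ <-]; rewrite le_max.
have [x_mu|x_mu] := leP 0 (dotv x mu).
  by rewrite (ahD_le_axis P mu x).
apply/orP; right; apply: ahD_le_axis.
- exact: sphereN.
- exact: rotationally_symmetricN.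
- by rewrite dotvC dotvNl dotvC oppr_ge0 ltW.
Qed.
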